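(* Let $f(z)=\sum_{j=0}^{\infty}a_{j}z^{j}$, $a_j\in\mathbb{R}$, be a real entire function, and suppose that $f$ has the Weierstrass factorization $$f(z)=z^{p}e^{Az^{2}+Bz+C}\prod_{j}\left(1-\frac{z}{z_{j}}\right)e^{z/z_{j}},$$ where $p\ge 0$ is an integer, $A,B\in\mathbb{R}$ and $C\in\mathbb{C}$ are constants, and $(z_j)$ is the (finite or infinite) list of the nonzero zeros of $f$, repeated according to multiplicity. Suppose that $\operatorname{Re} z_j<0$ for all $j$, that $A\ge 0$, that $\sum_{j}1/|z_{j}|$ converges, and that $B+\sum_{j}\frac{1}{z_{j}}>0$. Then for every integer $r$ with $0\le r<4$, every complex zero $z$ of the entire function $$f_{r}(z)=\sum_{j\equiv r \pmod 4}a_{j}z^{j}$$ lies on the $4$ radial rays given by $\operatorname{Im} z^{4}=0$ and $\operatorname{Re} z^{4}\le 0$.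
   Context: In $f_r$ the sum runs over all integers $j\ge0$ with $j\equiv r\pmod 4$. Because $f$ is real, its zeros are symmetric under complex conjugation with multiplicity, so $\sum_j 1/z_j$ is real. If the list $(z_j)$ is finite (or empty), the product and sums are finite (or empty). *)

(* Defs.v *)
From mathcomp Require Import all_boot all_order all_algebra.
From mathcomp Require Import all_classical all_reals all_analysis.
From mathcomp Require Import complex.

Set Implicit Arguments.
Unset Strict Implicit.
Unset Printing Implicit Defensive.

Import Order.TTheory GRing.Theory Num.Theory numFieldNormedType.Exports.

Local Open Scope classical_set_scope.
Local Open Scope ring_scope.
Local Open Scope complex_scope.
Local Open Scope card_scope.

(* The topology of the complex plane is found on the regular algebra R[i]^o
   only, hence the codomain R[i]^o of every sequence whose limit is taken. *)

(* A finite or infinite list of complex numbers is given by zs : nat -> R[i]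
   together with a set D of indices: the list consists of the zs j with D j, in
   increasing order of j. Values of zs outside D are irrelevant. *)

Definition partial_sum (R : realType) (D : pred nat) (u : nat -> R[i])
    (n : nat) : R[i]^o :=
  \sum_(0 <= j < n | D j) u j.

Definition partial_prod (R : realType) (D : pred nat) (u : nat -> R[i])
    (n : nat) : R[i]^o :=
  \prod_(0 <= j < n | D j) u j.

(* As every use of limn, this is meaningful for a convergent series only. *)
Definition csum (R : realType) (D : pred nat) (u : nat -> R[i]) : R[i] :=
  limn (partial_sum D u).

Definition cexp (R : realType) (z : R[i]) : R[i] :=
  (expR (complex.Re z))%:C * (cos (complex.Im z) +i* sin (complex.Im z)).

(* f is entire, with Taylor coefficients c at 0. *)
Definition entire_with_coefs (R : realType) (c : nat -> R[i])
    (f : R[i] -> R[i]) : Prop :=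
  forall z : R[i],
    partial_sum predT (fun j => c j * z ^+ j) @ \oo --> (f z : R[i]^o).

(* m = 0 is allowed and says that f w is nonzero. *)
Definition zero_of_order (R : realType) (f : R[i] -> R[i]) (w : R[i])
    (m : nat) : Prop :=
  exists (c : nat -> R[i]) (g : R[i] -> R[i]),
    [/\ entire_with_coefs c g, g w != 0
      & forall z, f z = (z - w) ^+ m * g z].

Definition lists_nonzero_zeros (R : realType) (f : R[i] -> R[i])
    (D : pred nat) (zs : nat -> R[i]) : Prop :=
  (forall j, D j -> zs j != 0) /\
  (forall w : R[i], w != 0 ->
     exists2 m : nat, [set j | D j /\ zs j = w] #= `I_m
                    & zero_of_order f w m).

Definition weierstrass_factorization (R : realType) (f : R[i] -> R[i])
    (p : nat) (A B : R) (C : R[i]) (D : pred nat) (zs : nat -> R[i]) : Prop :=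
  forall z : R[i], exists2 P : R[i],
    partial_prod D (fun j => (1 - z / zs j) * cexp (z / zs j)) @ \oo
      --> (P : R[i]^o)
    & f z = z ^+ p * cexp (A%:C * z ^+ 2 + B%:C * z + C) * P.

Definition section4 (R : realType) (a : nat -> R) (r : nat) (z : R[i]) : R[i] :=
  csum (fun j => j == r %[mod 4])%N (fun j => (a j)%:C * z ^+ j).

(* Main.v *)
Require Import Defs.
From mathcomp Require Import all_boot all_order all_algebra.
From mathcomp Require Import all_classical all_reals all_analysis.
From mathcomp Require Import complex ring lra zify.
Import Order.TTheory GRing.Theory Num.Theory numFieldNormedType.Exports.
Local Open Scope classical_set_scope.
Local Open Scope ring_scope.
Local Open Scope complex_scope.

(** Write f(z) = z^p exp(C) L(z) with L(z) = exp(Az^2+bz) prod(1-z/z_j) and b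
    = B + sum 1/z_j > 0. Averaging over the fourth roots of unity, 4f_r(z) is
    z^p exp(C) times L(z)+eL(iz)+e^2L(-z)+e^3L(-iz) with e a power of i
    (quarter_section_average). Since e^2 = 1 or -1, this is E(z)+eE(iz) or
    O(z)+eO(iz), where E(z)=L(z)+L(-z) and O(z)=L(z)-L(-z). So the theorem
    follows once |E(z)| and |E(iz)| differ, and |O(z)| and |O(iz)| differ,
    whenever Re z^2 is not 0 (normalized_quarter_turn, section_neq0).

    For a real polynomial P in place of L this is a twofold use of the
    Hermite-Biehler argument. If all roots of P lie in the closed left
    half-plane, and one of them in the open one, then |P(z)| > |P(-conj(z))|
    for Re z > 0, so the even and odd parts of P have purely imaginary roots
    (paraconj_combination_root). If Q has purely imaginary roots, Q(z) Q(-z)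
    is a multiple of prod (1 + t w) with w = z^2 and t >= 0, and for Re w > 0
    every factor satisfies |1 + t w| >= |1 - t w|: the value at z dominates
    that at iz.

    The function L is the pointwise limit of the polynomials
    (1+bz/n)^n(1+Az^2/n)^n prod_{j<n}(1-z/z_j), whose roots lie in the closed
    left half-plane because A >= 0, b > 0 and Re z_j < 0. A strict inequality
    must survive the limit, so the domination is made quantitative
    (imaginary_roots_prod_ratio): the gain depends only on bounds for the sum
    of the parameters t. These are read off from the values of Q at two real
    points, and the growth of L on the real axis, |L(x)| - |L(-x)| >=
    exp(bx)-exp(-bx), supplies them uniformly (limit_quarter_turn_lt).
    Pointwise convergence is then enough.

    The partial products over the zeros need not be real, which is why the
    even and odd parts of P are replaced by P + P# and P - P# with
    P#(z)=conj(P(-conj(z))). Their limits are E and O because L commutes with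
    conjugation; this follows from the realness of f once exp(C) is known to
    be real (cexp_const_real). *)

Set Implicit Arguments.
Unset Strict Implicit.
Unset Printing Implicit Defensive.
Local Notation normc := Normc.normc.
Local Notation Re := complex.Re.
Local Notation Im := complex.Im.
(* Conjugation and imaginary unit as explicit pairs, which compute on real and
   imaginary parts. *)
Local Notation "z ^*" := (conjc z) : ring_scope.
Local Notation "''i'" := (Complex 0 1) : ring_scope.

(** * The real-valued modulus *)

Section Modulus.
Variable R : realType.
Implicit Types (z w : R[i]).

Lemma normC_normc z : `|z| = (normc z)%:C.
Proof. by []. Qed.

Lemma normc_ge0 z : 0 <= normc z.
Proof. by case: z => a b; apply: sqrtr_ge0. Qed.

Lemma sqr_normcE z : normc z ^+ 2 = Re z ^+ 2 + Im z ^+ 2.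
Proof. by case: z => a b; rewrite /= sqr_sqrtr// addr_ge0 ?sqr_ge0. Qed.

Lemma ler_normc_sqr z w : normc z ^+ 2 <= normc w ^+ 2 -> normc z <= normc w.
Proof. by rewrite ler_sqr ?nnegrE ?normc_ge0. Qed.

Lemma ltr_normc_sqr z w : normc z ^+ 2 < normc w ^+ 2 -> normc z < normc w.
Proof. by rewrite ltr_sqr ?nnegrE ?normc_ge0. Qed.

Lemma normc_eq0 z : (normc z == 0) = (z == 0).
Proof. by apply/eqP/eqP => [/Normc.eq0_normc//|->]; rewrite Normc.normc0. Qed.

Lemma normc_gt0 z : (0 < normc z) = (z != 0).
Proof. by rewrite lt0r normc_ge0 normc_eq0 andbT. Qed.

Lemma normcD_le z w : normc (z + w) <= normc z + normc w.
Proof. exact: le_normcD. Qed.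

Lemma normcB_ge z w : normc z - normc w <= normc (z - w).
Proof. by have := normcD_le (z - w) w; rewrite subrK lerBlDr. Qed.

Lemma normcX z n : normc (z ^+ n) = normc z ^+ n.
Proof.
by elim: n => [|n IH]; rewrite ?expr0 ?Normc.normc1// !exprS Normc.normcM IH.
Qed.

Lemma normc_prod (I : Type) (s : seq I) (P : pred I) (F : I -> R[i]) :
  normc (\prod_(i <- s | P i) F i) = \prod_(i <- s | P i) normc (F i).
Proof.
by apply: (big_morph _ (@Normc.normcM R)); rewrite Normc.normc1.
Qed.

Lemma normcR (x : R) : normc x%:C = `|x|.
Proof. by rewrite /= expr0n /= addr0 sqrtr_sqr. Qed.

Lemma normc_conj z : normc z^* = normc z.
Proof. by case: z => a b /=; rewrite sqrrN. Qed.

Lemma normc_Re_le z : `|Re z| <= normc z.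
Proof. by rewrite -lecR -normC_normc normc_ge_Re. Qed.

Lemma normc_Im_le z : `|Im z| <= normc z.
Proof.
by case: z => a b /=; rewrite -sqrtr_sqr ler_wsqrtr// lerDr sqr_ge0.
Qed.

Lemma normc_le_ReIm z : normc z <= `|Re z| + `|Im z|.
Proof.
rewrite [X in normc X]complexE; apply: le_trans (normcD_le _ _) _.
rewrite Normc.normcM normcR normcR.
by rewrite /= expr0n expr1n add0r sqrtr1 mul1r.
Qed.

End Modulus.

(** * Limits of complex sequences *)

Section ComplexLimits.
Variable R : realType.
Implicit Types (u v : nat -> R[i]) (l m : R[i]).

(** The regular algebra in the codomain is what gives the sequence a topology;
    packing it here lets u and l be plain complex numbers elsewhere. *)
Definition tends u l := (u : nat -> R[i]^o) @ \oo --> (l : R[i]^o).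

Lemma tends_normcP u l :
  tends u l <-> (fun n => normc (u n - l)) @ \oo --> (0 : R).
Proof.
rewrite /tends; split.
  move=> /cvgrPdist_lt H; apply/cvgrPdist_lt => e e0.
  have := H e%:C; rewrite ltcR => /(_ e0).
  apply: filterS => n h; rewrite sub0r normrN ger0_norm ?normc_ge0//.
  have {h} : (normc (l - u n))%:C < e%:C := h.
  by rewrite ltcR -normcN opprB.
move=> /cvgrPdist_lt H; apply/cvgrPdist_lt => e.
rewrite ltcE /= => /andP[/eqP Ie e0].
have := H _ e0; apply: filterS => n.
rewrite sub0r normrN ger0_norm ?normc_ge0// => h.
suff : (normc (l - u n))%:C < e by [].
by rewrite ltcE /= Ie eqxx /= -normcN opprB.
Qed.

Lemma tends_ext u v l : (forall n, u n = v n) -> tends u l -> tends v l.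
Proof. by move=> /funext ->. Qed.

Lemma tends_cst l : tends (fun=> l) l.
Proof. exact: cvg_cst. Qed.

Lemma tendsD u v l m : tends u l -> tends v m ->
  tends (fun n => u n + v n) (l + m).
Proof. exact: cvgD. Qed.

Lemma tendsB u v l m : tends u l -> tends v m ->
  tends (fun n => u n - v n) (l - m).
Proof. exact: cvgB. Qed.

Lemma tendsM u v l m : tends u l -> tends v m ->
  tends (fun n => u n * v n) (l * m).
Proof. exact: cvgM. Qed.

Lemma tendsV u l : l != 0 -> tends u l -> tends (fun n => (u n)^-1) l^-1.
Proof. exact: cvgV. Qed.

Lemma tends_lim u l : tends u l -> limn (u : nat -> R[i]^o) = l.
Proof. by move=> h; apply: cvg_lim. Qed.

Lemma tends_unique u l m : tends u l -> tends u m -> l = m.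
Proof. by move=> /tends_lim <- /tends_lim. Qed.

Lemma tends_normc u l : tends u l -> (fun n => normc (u n)) @ \oo --> normc l.
Proof.
move=> /tends_normcP h; apply/cvgrPdist_le => e e0.
move/cvgrPdist_le : h => /(_ e e0); apply: filterS => n.
rewrite sub0r normrN ger0_norm ?normc_ge0// => h.
apply: le_trans h; have h1 := normcB_ge (u n) l; have := normcB_ge l (u n).
rewrite -(normcN (l - u n)) opprB => h2; rewrite ler_norml.
by apply/andP; split; lra.
Qed.

Lemma tends_conj u l : tends u l -> tends (fun n => (u n)^*) l^*.
Proof.
move=> /tends_normcP h; apply/tends_normcP; apply: cvg_trans h.
by under eq_fun do rewrite -rmorphB normc_conj.
Qed.

Lemma tends_ReIm u l : tends u l <->
  (fun n => Re (u n)) @ \oo --> Re l /\ (fun n => Im (u n)) @ \oo --> Im l.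
Proof.
split=> [/tends_normcP/cvgrPdist_le h|[/cvgrPdist_le h1 /cvgrPdist_le h2]].
  split; apply/cvgrPdist_le => e e0; have := h e e0; apply: filterS => n;
  rewrite sub0r normrN ger0_norm ?normc_ge0// distrC; apply: le_trans.
    by have := normc_Re_le (u n - l); rewrite raddfB.
  by have := normc_Im_le (u n - l); rewrite raddfB.
apply/tends_normcP/cvgrPdist_le => e e0; near=> n.
rewrite sub0r normrN ger0_norm ?normc_ge0//.
apply: le_trans (normc_le_ReIm _) _; rewrite !raddfB /= (splitr e) lerD //.
  by rewrite distrC; near: n; apply: h1; rewrite divr_gt0.
by rewrite distrC; near: n; apply: h2; rewrite divr_gt0.
Unshelve. all: by end_near. Qed.

Lemma tends_normc_le u v l m : tends u l -> tends v m ->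
  (forall n, normc (u n) <= normc (v n)) -> normc l <= normc m.
Proof.
move=> /tends_normc hu /tends_normc hv h.
by apply: (ler_cvg_to hu hv); apply: nearW.
Qed.

End ComplexLimits.

(** * The exponential as a limit of powers *)

Section ComplexExponential.
Variable R : realType.
Implicit Types (z w : R[i]).

Lemma cexp0 : cexp (0 : R[i]) = 1.
Proof. by rewrite /cexp /= expR0 cos0 sin0 mul1r. Qed.

Lemma cexpD z w : cexp (z + w) = cexp z * cexp w.
Proof.
case: z w => [a b] [c d]; rewrite /cexp /= expRD cosD sinD; simpc.
by congr (_ +i* _); ring.
Qed.

Lemma cexp_natM n z : cexp (n%:R * z) = cexp z ^+ n.
Proof.
elim: n => [|n IH]; first by rewrite mul0r cexp0.
by rewrite -natr1 mulrDl mul1r cexpD IH exprSr.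
Qed.

Lemma normc_cexp z : normc (cexp z) = expR (Re z).
Proof.
case: z => a b; rewrite /cexp Normc.normcM normcR ger0_norm ?expR_ge0//=.
by rewrite cos2Dsin2 sqrtr1 mulr1.
Qed.

Lemma cexp_neq0 z : cexp z != 0.
Proof. by rewrite -normc_gt0 normc_cexp expR_gt0. Qed.

Lemma cexp_real (x : R) : cexp x%:C = (expR x)%:C.
Proof. by rewrite /cexp /= cos0 sin0 mulr1. Qed.

Lemma cvgn_ext (u v : nat -> R) (l : R) : (forall n, u n = v n) ->
  u @ \oo --> l -> v @ \oo --> l.
Proof. by move=> /funext ->. Qed.

Lemma is_derive_seq_quotient (f : R -> R) (d : R) : is_derive (0 : R) 1 f d ->
  (fun n => n.+1%:R * (f n.+1%:R^-1 - f 0)) @ \oo --> d.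
Proof.
move=> [h <-]; have {}h : (fun h => h^-1 *: (f (h *: 1 + 0) - f 0)) @ 0^' -->
    'D_1 f 0 by exact: h.
move/cvgr_dnbhsP: h => /(_ (fun n => n.+1%:R^-1)).
have n0 n : (n.+1%:R^-1 : R) != 0 by rewrite invr_eq0 pnatr_eq0.
move=> /(_ (conj n0 cvg_harmonic)); apply: cvgn_ext => n.
by rewrite invrK addr0 [_%:A]mulr1.
Qed.

(** The real and imaginary parts of t |-> cexp (t z) have derivatives Re z and
    Im z at 0; the claim is the difference quotient at t = 1/(n+1). *)
Lemma cexp_difference_quotient z :
  tends (fun n => n.+1%:R * (cexp (z / n.+1%:R) - 1)) z.
Proof.
have E n : z / n.+1%:R = (Re z * n.+1%:R^-1) +i* (Im z * n.+1%:R^-1) :> R[i].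
  case: z => a b /=; rewrite -[n.+1%:R : R[i]](rmorph_nat (real_complex R)).
  by rewrite -fmorphV /=; simpc.
have N n : n.+1%:R = (n.+1%:R : R)%:C by rewrite rmorph_nat.
apply/tends_ReIm; split.
  have h := @is_derive_seq_quotient
    (fun t => expR (Re z * t) * cos (Im z * t)) (Re z).
  apply: cvgn_ext (h _).
    move=> n; rewrite E N /cexp /= !mulr0 expR0 cos0; simpc; rewrite /=; simpc.
    by [].
  have hl (c : R) : is_derive (0 : R) 1 (fun t => c * t) c.
    by apply: is_derive_eq; rewrite /GRing.scale /= mulr1.
  have he := is_derive1_comp (is_derive_expR (Re z * 0)) (hl _).
  have hc := is_derive1_comp (is_derive_cos (Im z * 0)) (hl _).
  apply: is_derive_eq (is_deriveM he hc) _.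
  rewrite /GRing.scale /= !mulr0 expR0 sin0 cos0; ring.
have h := @is_derive_seq_quotient
  (fun t => expR (Re z * t) * sin (Im z * t)) (Im z).
apply: cvgn_ext (h _).
  by move=> n; rewrite E N /cexp /= !mulr0 sin0; simpc; rewrite /=; simpc.
have hl (c : R) : is_derive (0 : R) 1 (fun t => c * t) c.
  by apply: is_derive_eq; rewrite /GRing.scale /= mulr1.
have he := is_derive1_comp (is_derive_expR (Re z * 0)) (hl _).
have hc := is_derive1_comp (is_derive_sin (Im z * 0)) (hl _).
apply: is_derive_eq (is_deriveM he hc) _.
rewrite /GRing.scale /= !mulr0 expR0 sin0 cos0; ring.
Qed.

Lemma tends_normc_dom (u v : nat -> R[i]) (l m : R[i]) (c : R) :
  (forall n, normc (u n - l) <= c * normc (v n - m)) ->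
  tends v m -> tends u l.
Proof.
move=> h /tends_normcP hv; apply/tends_normcP.
apply: (@squeeze_cvgr _ _ _ _ (fun=> 0) (fun n => c * normc (v n - m))).
- by apply: nearW => n; rewrite normc_ge0 h.
- exact: cvg_cst.
- by rewrite -[X in _ --> X](mulr0 c); apply: cvgMr.
Qed.

Lemma normc_subXX_le (z w : R[i]) (m : R) n : 1 <= m ->
  normc z <= m -> normc w <= m ->
  normc (z ^+ n - w ^+ n) <= m ^+ n * (n%:R * normc (z - w)).
Proof.
move=> m1 hz hw; rewrite subrXX Normc.normcM mulrA [X in _ <= X]mulrC.
have m0 : 0 <= m by exact: le_trans m1.
apply: ler_wpM2l; first exact: normc_ge0.
apply: (@le_trans _ _ (\sum_(i < n) m ^+ n)); last first.
  by rewrite sumr_const card_ord mulr_natr.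
elim/big_ind2: _ => [|a b c d ha hc|i _]; first by rewrite Normc.normc0.
  by apply: le_trans (normcD_le _ _) _; apply: lerD.
rewrite Normc.normcM !normcX.
apply: (@le_trans _ _ (m ^+ (n.-1 - i) * m ^+ i)).
  by apply: ler_pM; rewrite ?exprn_ge0 ?normc_ge0// lerXn2r ?nnegrE ?normc_ge0.
rewrite -exprD ler_weXn2l//; have := ltn_ord i; lia.
Qed.

(** Since cexp z is the n-th power of cexp (z/n), and both cexp (z/n) and 1 +
    z/n have modulus at most exp (|z|/n), the two powers differ by at most
    n*exp(|z|) times cexp (z/n) - (1 + z/n), which is o(1/n) by
    cexp_difference_quotient. *)
Lemma tends_exp z :
  tends (fun n => (1 + z / n.+1%:R) ^+ n.+1) (cexp z).
Proof.
have hz := @cexp_difference_quotient z.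
apply: (@tends_normc_dom _ _ _ _ (expR (normc z)) _ hz) => n {hz}.
have n0 : (n.+1%:R : R[i]) != 0 by rewrite pnatr_eq0.
have N : normc (n.+1%:R : R[i]) = n.+1%:R.
  by rewrite -(rmorph_nat (real_complex R)) normcR ger0_norm.
have Nz : normc (z / n.+1%:R) = normc z / n.+1%:R.
  by rewrite Normc.normcM Normc.normcV N.
have -> : cexp z = cexp (z / n.+1%:R) ^+ n.+1.
  by rewrite -cexp_natM mulrC divfK.
set m := expR (normc z / n.+1%:R).
have -> : expR (normc z) = m ^+ n.+1.
  by rewrite -expRM_natl mulrC divfK// pnatr_eq0.
have -> : n.+1%:R * (cexp (z / n.+1%:R) - 1) - z =
    n.+1%:R * (cexp (z / n.+1%:R) - (1 + z / n.+1%:R)) by field.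
rewrite Normc.normcM N -normcN opprB; apply: normc_subXX_le.
- by rewrite /m -expR0 ler_expR divr_ge0// normc_ge0.
- rewrite normc_cexp ler_expR -Nz.
  exact: le_trans (ler_norm _) (normc_Re_le _).
- apply: le_trans (normcD_le _ _) _; rewrite Normc.normc1 Nz.
  exact: expR_ge1Dx.
Qed.

End ComplexExponential.

(** * Polynomials with roots in the left half-plane *)

Section HermiteBiehler.
Variable R : realType.
Implicit Types (z w a : R[i]) (P Q : {poly R[i]}) (s : seq R[i]).

(** The reflection z |-> - z^* in the imaginary axis moves a point of the
    right half-plane closer to the root -1/a when that root is on the left.
    The exact difference of the squared moduli gives the weak and the strict
    inequality at once. *)
Lemma linear_factor_reflect a z :
  normc (1 + a * z) ^+ 2 = normc (1 + a * - z^*) ^+ 2 + 4 * Re a * Re z.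
Proof. by case: a z => [s t] [x y]; rewrite !sqr_normcE /=; ring. Qed.

Lemma linear_factor_reflect_le a z : 0 <= Re a -> 0 <= Re z ->
  normc (1 + a * - z^*) <= normc (1 + a * z).
Proof.
move=> ha hz; apply: ler_normc_sqr; rewrite [X in _ <= X]linear_factor_reflect.
by rewrite lerDl !mulr_ge0.
Qed.

Lemma linear_factor_reflect_lt a z : 0 < Re a -> 0 < Re z ->
  normc (1 + a * - z^*) < normc (1 + a * z).
Proof.
move=> ha hz; apply: ltr_normc_sqr; rewrite [X in _ < X]linear_factor_reflect.
by rewrite ltrDl !mulr_gt0.
Qed.

Lemma linear_factor_neq0 a z : 0 <= Re a -> 0 < Re z -> 1 + a * z != 0.
Proof.
case: a z => [s t] [x y] /= hs hx; apply/eqP => /eqP.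
rewrite eq_complex /= => /andP[/eqP h1 /eqP h2].
have : s * (x ^+ 2 + y ^+ 2) = - x.
  have -> : s * (x ^+ 2 + y ^+ 2) =
    x * (1 + (s * x - t * y)) + y * (0 + (s * y + t * x)) - x by ring.
  by rewrite h1 h2; ring.
have := mulr_ge0 hs (addr_ge0 (sqr_ge0 x) (sqr_ge0 y)); lra.
Qed.

(** Encoding a root as its slope a = -1/root keeps the constant coefficient
    equal to 1 and turns the condition on the root into 0 <= Re a. *)
Definition linear_prod s : {poly R[i]} := \prod_(a <- s) (1 + a%:P * 'X).

Lemma horner_linear_prod s z :
  (linear_prod s).[z] = \prod_(a <- s) (1 + a * z).
Proof.
rewrite /linear_prod horner_prod; apply: eq_bigr => a _.
by rewrite !hornerE.
Qed.

Lemma linear_prod0 s : (linear_prod s).[0] = 1.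
Proof. by rewrite horner_linear_prod big1// => a _; rewrite mulr0 addr0. Qed.

Lemma linear_prod_coef1 s : (linear_prod s)`_1 = \sum_(a <- s) a.
Proof.
rewrite /linear_prod; elim: s => [|a s IH]; first by rewrite !big_nil coef1.
have h0 := linear_prod0 s; rewrite horner_coef0 /linear_prod in h0.
rewrite !big_cons mulrDl mul1r coefD IH -mulrA coefCM coefXM /= h0 mulr1.
by rewrite addrC.
Qed.

Lemma linear_prod_reflect_le s z : {in s, forall a, 0 <= Re a} -> 0 <= Re z ->
  normc (linear_prod s).[- z^*] <= normc (linear_prod s).[z].
Proof.
move=> hs hz; rewrite !horner_linear_prod !normc_prod.
rewrite big_seq [X in _ <= X]big_seq; apply: ler_prod => a /hs ha.
by rewrite normc_ge0 linear_factor_reflect_le.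
Qed.

Lemma linear_prod_neq0 s z : {in s, forall a, 0 <= Re a} -> 0 < Re z ->
  (linear_prod s).[z] != 0.
Proof.
move=> hs hz; rewrite horner_linear_prod prodf_seq_neq0; apply/allP => a /hs ha.
by apply/implyP => _; apply: linear_factor_neq0.
Qed.

Lemma linear_prod_reflect_lt b s z :
  0 < Re b -> {in s, forall a, 0 <= Re a} -> 0 < Re z ->
  normc (linear_prod (b :: s)).[- z^*] < normc (linear_prod (b :: s)).[z].
Proof.
move=> hb hs hz; rewrite !horner_linear_prod !big_cons -!horner_linear_prod.
rewrite !Normc.normcM.
apply: (@le_lt_trans _ _ (normc (1 + b * - z^*) * normc (linear_prod s).[z])).
  by rewrite ler_wpM2l ?normc_ge0// linear_prod_reflect_le// ltW.
rewrite ltr_pM2r ?normc_gt0 ?linear_prod_neq0//.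
exact: linear_factor_reflect_lt.
Qed.

(** This is the polynomial z |-> conj P(- conj z), which is P(-z) when P is
    real; P + paraconj P and P - paraconj P then play the roles of the even
    and odd parts even for a P with nonreal coefficients. *)
Definition paraconj P : {poly R[i]} := (map_poly conjc P) \Po (- 'X).

Lemma horner_paraconj P z : (paraconj P).[z] = (P.[- z^*])^*.
Proof.
rewrite /paraconj horner_comp hornerN hornerX -[- z]conjcK horner_map.
by rewrite rmorphN.
Qed.

Lemma paraconj_coef1 P : (paraconj P)`_1 = - (P`_1)^*.
Proof.
have h Q : Q`_1 = (Q^`()).[0] by rewrite horner_coef0 coef_deriv.
rewrite h /paraconj deriv_comp hornerM derivN derivX hornerN hornerC.
rewrite horner_comp hornerN hornerX oppr0 mulrN1 horner_coef0 coef_deriv.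
by rewrite coef_map.
Qed.

(** At a root P and its paraconjugate have equal moduli, that is, |P(z)| =
    |P(- conj z)|, while the hypothesis makes one of them strictly larger on
    either side of the imaginary axis. *)
Lemma paraconj_combination_root P e z :
  (forall z, 0 < Re z -> normc P.[- z^*] < normc P.[z]) ->
  normc e = 1 -> root (P + e *: paraconj P) z -> Re z = 0.
Proof.
move=> hP he; rewrite rootE hornerD hornerZ horner_paraconj addr_eq0 => /eqP h.
have {}h : normc P.[z] = normc P.[- z^*].
  by rewrite h normcN Normc.normcM he mul1r normc_conj.
apply/eqP; rewrite eq_le !leNgt; apply/andP; split; apply/negP => hz.
  by have := hP _ hz; rewrite h ltxx.
have E : - (- z^*)^* = z by case: (z) => x y; simpc.
have := hP (- z^*); rewrite E h ltxx.
by case: z hz {h E} => x y /= hx; rewrite oppr_gt0 => /(_ hx).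
Qed.

End HermiteBiehler.

(** * Polynomials with purely imaginary roots *)

Section ImaginaryRoots.
Variable R : realType.
Implicit Types (z w : R[i]) (Q : {poly R[i]}) (s : seq R).

(** The roots r = iy pair with -r in Q(z)Q(-z), and (z - r)(- z - r) = r^2 (1
    + z^2 / y^2). The reciprocals t = 1/y^2 serve as parameters since their
    sum stays bounded along a convergent sequence of polynomials. *)
Lemma imaginary_roots_prod Q : Q.[0] != 0 -> (forall z, root Q z -> Re z = 0) ->
  exists2 s : seq R, {in s, forall t, 0 <= t} &
    forall z, normc (Q.[z] * Q.[- z]) =
      normc Q.[0] ^+ 2 * \prod_(t <- s) normc (1 + t%:C * z ^+ 2).
Proof.
move=> Q0 hQ; have [rs EQ] := closed_field_poly_normal Q.
have H z : Q.[z] = lead_coef Q * \prod_(r <- rs) (z - r).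
  rewrite {1}EQ hornerZ horner_prod; congr (_ * _).
  by apply: eq_bigr => r _; rewrite !hornerE.
exists [seq (Im r ^+ 2)^-1 | r <- rs].
  by move=> t /mapP[r _ ->]; rewrite invr_ge0 sqr_ge0.
move=> z; rewrite big_map -normcX -normc_prod -Normc.normcM; congr normc.
rewrite !H mulrACA -big_split /= exprMn -prodrXl -[in RHS]mulrA -big_split /=.
congr (_ * _).
apply: eq_big_seq => r rrs.
have r0 : Re r = 0.
  by apply: hQ; rewrite rootE H (big_rem r)//= subrr mul0r mulr0.
have rn0 : r != 0.
  apply: contra_neq Q0 => r00.
  by rewrite H (big_rem r)//= r00 subr0 mul0r mulr0.
case: r r0 rn0 {rrs} => x y /= ->; rewrite eq_complex /= eqxx /= => y0.
have -> : (0 +i* y) = 'i * y%:C :> R[i] by simpc.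
have -> : (y ^+ 2)^-1%:C = (y%:C ^+ 2)^-1 by rewrite fmorphV rmorphXn.
have yn : y%:C != 0 :> R[i] by rewrite eq_complex /= negb_and y0.
have -> : (z - 'i * y%:C) * (- z - 'i * y%:C) = 'i ^+ 2 * y%:C ^+ 2 - z ^+ 2.
  by ring.
rewrite sub0r sqrrN exprMn sqr_i; field.
exact: yn.
Qed.

Lemma sum_le_prod1D s : {in s, forall t, 0 <= t} ->
  1 + \sum_(t <- s) t <= \prod_(t <- s) (1 + t).
Proof.
elim: s => [|t s IH] h; first by rewrite !big_nil addr0.
have t0 : 0 <= t by apply: h; rewrite mem_head.
have hs : {in s, forall t, 0 <= t}.
  by move=> x xs; apply: h; rewrite inE xs orbT.
have S0 : 0 <= \sum_(t <- s) t by rewrite big_seq sumr_ge0.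
rewrite !big_cons; have := IH hs; nra.
Qed.

Lemma ln_prod1D_le s : {in s, forall t, 0 <= t} ->
  ln (\prod_(t <- s) (1 + t)) <= \sum_(t <- s) t.
Proof.
move=> h; rewrite -ler_expR lnK; last first.
  rewrite posrE big_seq; apply: prodr_gt0 => t /h t0; lra.
rewrite expR_sum big_seq [X in _ <= X]big_seq; apply: ler_prod => t /h t0.
by rewrite expR_ge1Dx andbT; lra.
Qed.

Lemma normc_1Dmul_ge1 (t : R) w : 0 <= t -> 0 <= Re w ->
  1 <= normc (1 + t%:C * w).
Proof.
move=> t0 w0; apply: le_trans (normc_Re_le _).
apply: le_trans (ler_norm _); case: w w0 => u v /= u0.
by rewrite mul0r subr0 lerDl mulr_ge0.
Qed.

(** Factor by factor |1 + tw|^2 - |1 - tw|^2 = 4 t Re w, so every factor gains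
    a ratio 1 + ct, with a common c because |1 - tw| <= 1 + T|w|. The product
    of the gains is at least 1 + c (sum of the t), and the last hypothesis
    bounds that sum below by (ln 2)/x. Besides w, only T and x enter the gain,
    which makes the bound uniform along a sequence of products. *)
Lemma imaginary_roots_prod_ratio s w (T x : R) :
  {in s, forall t, 0 <= t} -> 0 < Re w -> 0 < x ->
  \prod_(t <- s) (1 + t) <= T -> 2 <= \prod_(t <- s) (1 + x * t) ->
  (1 + 4 * Re w / (1 + T * normc w) ^+ 2 * (ln 2 / x)) *
    (\prod_(t <- s) normc (1 - t%:C * w)) ^+ 2 <=
  (\prod_(t <- s) normc (1 + t%:C * w)) ^+ 2.
Proof.
move=> hs hw x0 hT hx; set c := 4 * Re w / _.
have T0 : 0 <= T.
  apply: le_trans hT; rewrite big_seq prodr_ge0// => t /hs; lra.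
have S : {in s, forall t, t <= T}.
  move=> t ts; apply: le_trans hT; apply: le_trans (sum_le_prod1D hs).
  rewrite (big_rem t)//= [t + _]addrC addrA lerDr addr_ge0//.
  by rewrite big_seq sumr_ge0// => r /mem_rem /hs.
have d0 : 0 < 1 + T * normc w.
  by rewrite ltr_wpDr// mulr_ge0// normc_ge0.
have c0 : 0 <= c by rewrite /c divr_ge0 ?sqr_ge0//; lra.
have lnS : ln 2 / x <= \sum_(t <- s) t.
  rewrite ler_pdivrMr// mulrC mulr_sumr -(big_map (fun t => x * t) xpredT id).
  apply: le_trans (ln_prod1D_le _); last first.
    by move=> t /mapP[r /hs r0 ->]; rewrite mulr_ge0// ltW.
  rewrite big_map ler_ln ?posrE//; exact: lt_le_trans hx.
apply: (@le_trans _ _ (\prod_(t <- s) (1 + c * t) *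
    (\prod_(t <- s) normc (1 - t%:C * w)) ^+ 2)).
  apply: ler_wpM2r; first exact: sqr_ge0.
  rewrite -(big_map (fun t => c * t) xpredT (fun t => 1 + t)).
  apply: le_trans (sum_le_prod1D _); last first.
    by move=> t /mapP[r /hs r0 ->]; rewrite mulr_ge0.
  by rewrite big_map -mulr_sumr lerD2l ler_wpM2l.
rewrite -!prodrXl -big_split /= big_seq [X in _ <= X]big_seq.
apply: ler_prod => t ts; have t0 := hs t ts; have tT := S t ts.
rewrite mulr_ge0 ?sqr_ge0 ?(addr_ge0 _ (mulr_ge0 c0 t0))//=.
have -> : normc (1 + t%:C * w) ^+ 2 =
    normc (1 - t%:C * w) ^+ 2 + 4 * t * Re w.
  by rewrite !sqr_normcE; case: w {hw hT hx S d0 c0 lnS c} => u v /=; ring.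
rewrite mulrDl mul1r lerD2l.
have h : normc (1 - t%:C * w) ^+ 2 <= (1 + T * normc w) ^+ 2.
  rewrite ler_sqr ?nnegrE ?normc_ge0 ?(ltW d0)//.
  apply: le_trans (normcD_le _ _) _; rewrite Normc.normc1 lerD2l normcN.
  by rewrite Normc.normcM normcR ger0_norm// ler_wpM2r// normc_ge0.
rewrite /c; set N := normc _ ^+ 2 in h *; set D := _ ^+ 2 in h *.
have -> : 4 * Re w / D * t * N = 4 * t * Re w * (N / D) by ring.
rewrite ler_piMr ?mulr_ge0 ?(ltW hw)//.
by rewrite ler_pdivrMr ?mul1r// exprn_gt0.
Qed.

End ImaginaryRoots.

(** * Comparison of a limit at z and at iz *)

Section LimitDomination.
Variable R : realType.
Implicit Types (z w : R[i]).

(** Multiplying z by i changes the sign of w = z^2, so the ratio bound applies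
    to Q(z)Q(-z) and Q(iz)Q(-iz). The values at 1 and at x control the sum of
    the parameters t from above and below; the factor 2 at x survives the
    division by |Q(0)|^2, which is at most T. All constants depend on b, T, x
    and z alone. *)
Lemma imaginary_roots_quarter_turn (Q : {poly R[i]}) (b T x : R) z :
  (forall y, root Q y -> Re y = 0) -> 0 < b -> b <= normc Q.[0] -> 0 < x ->
  normc (Q.[1] * Q.[- 1]) <= T -> 2 * T <= normc (Q.[x%:C] * Q.[- x%:C]) ->
  0 < Re (z ^+ 2) ->
  b ^+ 2 <= normc (Q.[z] * Q.[- z]) /\
  (1 + 4 * Re (z ^+ 2) / (1 + T / b ^+ 2 * normc (z ^+ 2)) ^+ 2 *
         (ln 2 / x ^+ 2)) * normc (Q.['i * z] * Q.[- ('i * z)]) ^+ 2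
    <= normc (Q.[z] * Q.[- z]) ^+ 2.
Proof.
move=> hQ b0 hb x0 hT hx hz.
have Q0 : Q.[0] != 0 by rewrite -normc_gt0; exact: lt_le_trans hb.
have [s s0 Es] := imaginary_roots_prod Q0 hQ.
have hb2 : b ^+ 2 <= normc Q.[0] ^+ 2.
  by rewrite ler_sqr ?nnegrE ?normc_ge0// ltW.
have b20 : 0 < b ^+ 2 by rewrite exprn_gt0.
set q := normc Q.[0] ^+ 2 in Es hb2.
have q0 : 0 < q by exact: lt_le_trans hb2.
have norm_real (t y : R) : 0 <= t ->
    normc (1 + t%:C * y%:C ^+ 2) = 1 + y ^+ 2 * t.
  move=> t0; have -> : 1 + t%:C * y%:C ^+ 2 = (1 + y ^+ 2 * t)%:C :> R[i].
    by rewrite !rmorphD !rmorphM /= expr2; ring.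
  by rewrite normcR ger0_norm// addr_ge0// mulr_ge0// sqr_ge0.
have Er (y : R) : normc (Q.[y%:C] * Q.[- y%:C]) =
    q * \prod_(t <- s) (1 + y ^+ 2 * t).
  rewrite Es; congr (_ * _); apply: eq_big_seq => t /s0 t0; exact: norm_real.
have := Er 1; rewrite expr1n => E1; rewrite E1 in hT.
have {}E1 : \prod_(t <- s) (1 + 1 * t) = \prod_(t <- s) (1 + t).
  by apply: eq_bigr => t _; rewrite mul1r.
rewrite {}E1 in hT; rewrite Er in hx.
have P1 : 1 <= \prod_(t <- s) (1 + t).
  apply: le_trans (sum_le_prod1D s0).
  by rewrite lerDl big_seq sumr_ge0// => t /s0.
have qT : q <= T by apply: le_trans hT; rewrite ler_pMr.
split.
  rewrite Es; apply: le_trans hb2 _; rewrite ler_peMr ?(ltW q0)//.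
  rewrite big_seq; elim/big_rec: _ => // t p /s0 t0 hp.
  rewrite -[1]mulr1; apply: ler_pM => //; apply: normc_1Dmul_ge1 => //.
  exact: ltW.
rewrite !Es !exprMn sqr_i mulrCA ler_pM2l -?/q; last by rewrite mulr_gt0.
under [X in _ * X ^+ 2 <= _]eq_bigr do rewrite mulN1r mulrN.
apply: imaginary_roots_prod_ratio => //.
- by rewrite exprn_gt0.
- rewrite ler_pdivlMr//; apply: le_trans hT; rewrite mulrC ler_wpM2r//.
  exact: le_trans P1.
- rewrite -(ler_pM2l q0); apply: le_trans hx; rewrite mulrC.
  by rewrite ler_pM2l.
Qed.

(** The bounds of imaginary_roots_quarter_turn hold eventually with constants
    independent of n, hence they survive the limit, and the limit inequality
    is still strict. Growth of G on the real axis provides the point x at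
    which |G(x)|^2 exceeds twice T. *)
Lemma limit_quarter_turn_lt (Q : nat -> {poly R[i]}) (G : R[i] -> R[i])
    (b k : R) z :
  (forall n y, root (Q n) y -> Re y = 0) ->
  0 < b -> (forall n, b <= normc (Q n).[0]) ->
  (forall y, y != 0 -> tends (fun n => (Q n).[y]) (G y)) ->
  (forall y, y != 0 -> G (- y) = G y) ->
  0 < k -> (forall x : R, 0 < x -> k * x <= normc (G x%:C)) ->
  0 < Re (z ^+ 2) -> normc (G ('i * z)) < normc (G z).
Proof.
move=> hQ b0 hb hG Gev k0 hk hz.
have lim y : y != 0 -> (fun n => normc ((Q n).[y] * (Q n).[- y])) @ \oo -->
    normc (G y) ^+ 2.
  move=> y0; have := tendsM (hG _ y0) (hG (- y) _).
  by rewrite oppr_eq0 Gev// -expr2 => /(_ y0)/tends_normc; rewrite normcX.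
have z0 : z != 0 by apply: contraTneq hz => ->; rewrite expr0n /= ltxx.
have iz0 : 'i * z != 0.
  by rewrite mulf_neq0// eq_complex /= negb_and oner_eq0 orbT.
pose T := normc (G 1) ^+ 2 + 1.
have T1 : 1 <= T by rewrite lerDr sqr_ge0.
(* The growth bound gives |G(x)| >= 2T + 1, whose square exceeds 2T. *)
pose x := (2 * T + 1) / k.
have x0 : 0 < x by rewrite divr_gt0//; lra.
have hx : 2 * T < normc (G x%:C) ^+ 2.
  have := hk _ x0; rewrite /x mulrC divfK ?gt_eqF// => h.
  have : (2 * T + 1) ^+ 2 <= normc (G ((2 * T + 1) / k)%:C) ^+ 2.
    by rewrite ler_sqr ?nnegrE ?normc_ge0//; lra.
  by apply: lt_le_trans; nra.
have nT : \forall n \near \oo, normc ((Q n).[1] * (Q n).[- 1]) <= T.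
  apply: (cvgr_le _ (lim 1 _)); first exact: oner_neq0.
  by rewrite /T ltrDl.
have nx : \forall n \near \oo, 2 * T <= normc ((Q n).[x%:C] * (Q n).[- x%:C]).
  by apply: (cvgr_ge _ (lim x%:C _)) => //; rewrite eq_complex /= gt_eqF.
set d := 4 * Re (z ^+ 2) / (1 + T / b ^+ 2 * normc (z ^+ 2)) ^+ 2 *
         (ln 2 / x ^+ 2).
have d0 : 0 < d.
  have x20 : 0 < x ^+ 2 by rewrite exprn_gt0.
  have ln20 : 0 < ln 2 / x ^+ 2 by rewrite divr_gt0 ?ln_gt0 ?ltr1n.
  rewrite /d mulr_gt0// divr_gt0 ?(mulr_gt0 _ hz)// exprn_gt0//.
  rewrite ltr_pwDl// mulr_ge0 ?normc_ge0// divr_ge0 ?sqr_ge0//; lra.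
have low : b ^+ 2 <= normc (G z) ^+ 2.
  apply: ler_cvg_to (cvg_cst _) (lim z z0) _.
  near=> n.
  apply: (proj1 (imaginary_roots_quarter_turn (hQ n) b0 (hb n) x0 _ _ hz)).
    by near: n; exact: nT.
  by near: n; exact: nx.
have main : (1 + d) * (normc (G ('i * z)) ^+ 2) ^+ 2 <= (normc (G z) ^+ 2) ^+ 2.
  have l1 := lim _ z0; have l2 := lim _ iz0.
  apply: (ler_cvg_to (cvgM (cvg_cst (1 + d)) (cvgM l2 l2)) (cvgM l1 l1)).
  near=> n; rewrite /= -!expr2.
  apply: (proj2 (imaginary_roots_quarter_turn (hQ n) b0 (hb n) x0 _ _ hz)).
    by near: n; exact: nT.
  by near: n; exact: nx.
rewrite ltNge; apply/negP => h.
have h2 : normc (G z) ^+ 2 <= normc (G ('i * z)) ^+ 2.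
  by rewrite ler_sqr ?nnegrE ?normc_ge0.
have b20 : 0 < b ^+ 2 by rewrite exprn_gt0.
move: main; apply/negP; rewrite -ltNge.
set g := normc (G z) ^+ 2 in h2 low *; set g' := normc _ ^+ 2 in h2 *.
have : g ^+ 2 <= g' ^+ 2 by rewrite ler_sqr ?nnegrE//; lra.
have : 0 < d * g' ^+ 2 by rewrite mulr_gt0// exprn_gt0//; lra.
by lra.
Unshelve. all: by end_near. Qed.

End LimitDomination.

(** * Even and odd parts of a limit of stable polynomials *)

Section EvenOddParts.
Variable R : realType.
Implicit Types (z w : R[i]).

Variables (P : nat -> {poly R[i]}) (L : R[i] -> R[i]) (b : R).
Hypothesis P_reflect :
  forall n z, 0 < Re z -> normc (P n).[- z^*] < normc (P n).[z].
Hypothesis P0 : forall n, (P n).[0] = 1.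
Hypothesis b_gt0 : 0 < b.
Hypothesis P1 : forall n, b <= Re (P n)`_1.
Hypothesis P_lim : forall z, z != 0 -> tends (fun n => (P n).[z]) (L z).
Hypothesis L_conj : forall z, z != 0 -> L z^* = (L z)^*.
Hypothesis L_growth : forall x : R, 0 < x ->
  b * x + (b * x) ^+ 2 / 4 <= normc (L x%:C) - normc (L (- x%:C)).

(** The approximants need not be real, but their limit is: paraconjugation
    becomes z |-> - z in the limit. *)
Lemma tends_paraconj z : z != 0 ->
  tends (fun n => (paraconj (P n)).[z]) (L (- z)).
Proof.
move=> z0; have nz : - z^* != 0 by rewrite oppr_eq0 conjc_eq0.
have E : (- z^*)^* = - z by case: (z) => x y; simpc.
have h := tends_conj (@P_lim _ nz); rewrite -(L_conj nz) E in h.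
by apply: tends_ext h => n; rewrite horner_paraconj.
Qed.

(** P + paraconj P has imaginary roots, equals 2 at 0 and tends to twice the
    even part of L. *)
Lemma even_part_quarter_turn z : 0 < Re (z ^+ 2) ->
  normc (L ('i * z) + L (- ('i * z))) < normc (L z + L (- z)).
Proof.
have n1 : normc (1 : R[i]) = 1 by rewrite Normc.normc1.
apply: (@limit_quarter_turn_lt _ (fun n => P n + paraconj (P n))
  (fun z => L z + L (- z)) 2 b).
- move=> n y; rewrite -[paraconj _]scale1r.
  exact: paraconj_combination_root (P_reflect n) n1.
- by [].
- move=> n; rewrite hornerD horner_paraconj rmorph0 oppr0 P0 rmorph1.
  rewrite -[1 + 1]/(2%:R : R[i]) -(rmorph_nat (real_complex R) 2) normcR.
  by rewrite ger0_norm.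
- move=> y y0; apply: tends_ext (tendsD (P_lim y0) (tends_paraconj y0)) => n.
  by rewrite hornerD.
- by move=> y y0; rewrite opprK addrC.
- exact: b_gt0.
- move=> x x0; have h := L_growth x0.
  apply: (@le_trans _ _ (normc (L x%:C) - normc (L (- x%:C)))).
    by apply: le_trans h; rewrite lerDl divr_ge0// sqr_ge0.
  by rewrite -(normcN (L (- _))) -{2}(opprK (L (- _))); apply: normcB_ge.
Qed.

(** The odd part vanishes at 0, so limit_quarter_turn_lt is applied to its
    quotient by z. The division by X is exact because P(0) = 1 is real, and
    the value of the quotient at 0 is 2 Re P'(0), which stays away from 0. *)
Lemma odd_part_quarter_turn z : 0 < Re (z ^+ 2) ->
  normc (L ('i * z) - L (- ('i * z))) < normc (L z - L (- z)).
Proof.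
have n1 : normc (-1 : R[i]) = 1 by rewrite normcN Normc.normc1.
pose Q n := drop_poly 1 (P n - paraconj (P n)).
have QX n : Q n * 'X = P n - paraconj (P n).
  rewrite -[RHS](poly_take_drop 1) expr1; apply/esym/eqP.
  rewrite -subr_eq0 addrK; apply/eqP/polyP => -[|i];
    rewrite coef_take_poly ?coef0//=.
  rewrite coefB -!horner_coef0 horner_paraconj rmorph0 oppr0 P0 rmorph1.
  by rewrite subrr.
have QXz n y : y != 0 -> (Q n).[y] = ((P n).[y] - (paraconj (P n)).[y]) / y.
  by move=> y0; rewrite -hornerN -hornerD -QX hornerM hornerX mulfK.
move=> hz.
have z0 : z != 0 by apply: contraTneq hz => ->; rewrite expr0n /= ltxx.
have := @limit_quarter_turn_lt _ Q (fun z => (L z - L (- z)) / z)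
  (2 * b) (b ^+ 2 / 4) z.
rewrite !Normc.normcM !Normc.normcV Normc.normcM.
have -> : normc ('i : R[i]) = 1 by rewrite /= expr0n expr1n add0r sqrtr1.
rewrite mul1r ltr_pM2r ?invr_gt0 ?normc_gt0//; apply => //.
- move=> n y ry; apply: (paraconj_combination_root (P_reflect n) n1).
  rewrite scaleN1r -QX rootM ry //.
- by rewrite mulr_gt0.
- move=> n; rewrite horner_coef0 coef_drop_poly add0n coefB paraconj_coef1.
  apply: le_trans (normc_Re_le _); apply: le_trans (ler_norm _).
  have := P1 n; case: ((P n)`_1) => u v /=; lra.
- move=> y y0.
  have h := tendsM (tendsB (P_lim y0) (tends_paraconj y0)) (@tends_cst R y^-1).
  by apply: tends_ext h => n; rewrite QXz.
- by move=> y y0; rewrite opprK invrN mulrN -mulNr opprB.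
- by rewrite divr_gt0// exprn_gt0.
- move=> x x0; have h := L_growth x0.
  rewrite Normc.normcM Normc.normcV normcR gtr0_norm// ler_pdivlMr//.
  apply: le_trans (normcB_ge _ _); apply: le_trans h.
  have : 0 <= b * x by rewrite mulr_ge0 ?(ltW x0)// ltW.
  by rewrite exprMn => hbx; lra.
Qed.

End EvenOddParts.

(** * The product over the zeros *)

Section CanonicalProduct.
Variable R : realType.
Implicit Types (z w : R[i]).

Lemma tends_cexp (u : nat -> R[i]) l :
  tends u l -> tends (fun n => cexp (u n)) (cexp l).
Proof.
move=> /tends_ReIm[hr hi].
have he : (fun n => expR (Re (u n))) @ \oo --> expR (Re l).
  by apply: continuous_cvg hr; exact: continuous_expR.
have hc : (fun n => cos (Im (u n))) @ \oo --> cos (Im l).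
  by apply: continuous_cvg hi; exact: continuous_cos.
have hs : (fun n => sin (Im (u n))) @ \oo --> sin (Im l).
  by apply: continuous_cvg hi; exact: continuous_sin.
rewrite /cexp; apply: tendsM; apply/tends_ReIm; split=> //=; exact: cvg_cst.
Qed.

(** After expansion, the nonconstant terms of the product are dominated by
    those of the exponential series of the sum of the moduli. *)
Lemma normc_prod1D_sub1 (I : Type) (s : seq I) (P : pred I) (u : I -> R[i]) :
  normc (\prod_(i <- s | P i) (1 + u i) - 1) <=
  expR (\sum_(i <- s | P i) normc (u i)) - 1.
Proof.
elim/big_rec2: _ => [|i q p _ IH].
  by rewrite subrr expR0 subrr Normc.normc0.
have -> : (1 + u i) * p - 1 = (1 + u i) * (p - 1) + u i by ring.
apply: le_trans (normcD_le _ _) _; rewrite Normc.normcM expRD.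
have h1 : normc (1 + u i) <= 1 + normc (u i).
  by apply: le_trans (normcD_le _ _) _; rewrite Normc.normc1.
have h2 := expR_ge1Dx (normc (u i)).
have n0 := normc_ge0 (u i); have n1 := normc_ge0 (p - 1).
have h3 : normc (1 + u i) * normc (p - 1) <= expR (normc (u i)) * (expR q - 1).
  by apply: ler_pM; rewrite ?normc_ge0// (le_trans h1).
lra.
Qed.

Lemma dominated_sum_cvg (D : pred nat) (u v : nat -> R) :
  (forall j, D j -> `|u j| <= v j) ->
  cvgn (fun n => \sum_(0 <= j < n | D j) v j) ->
  cvgn (fun n => \sum_(0 <= j < n | D j) u j).
Proof.
move=> huv hv; pose u' j := if D j then u j else 0.
pose v' j := if D j then v j else 0.
have eu : (fun n => \sum_(0 <= j < n | D j) u j) = series u'.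
  by apply/funext => n; rewrite /series /= big_mkcond.
have ev : (fun n => \sum_(0 <= j < n | D j) v j) = series v'.
  by apply/funext => n; rewrite /series /= big_mkcond.
rewrite eu; rewrite ev in hv; apply: normed_cvg; apply: series_le_cvg hv => j.
- exact: normr_ge0.
- by rewrite /v'; case: ifP => // Dj; apply: le_trans (huv _ Dj).
- rewrite /= /u' /v'; case: ifP => [Dj|_]; [exact: huv | by rewrite normr0].
Qed.

Variables (D : pred nat) (zs : nat -> R[i]).
Hypothesis hre : forall j, D j -> Re (zs j) < 0.
Hypothesis hcvg : cvgn (partial_sum D (fun j => `|zs j|^-1)).

Lemma Re_opp_inv_ge0 j : D j -> 0 <= Re (- (zs j)^-1).
Proof.
move/hre; case: (zs j) => x y /= x0.
by rewrite oppr_ge0 mulr_le0_ge0 ?(ltW x0)// invr_ge0 addr_ge0 ?sqr_ge0.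
Qed.

Lemma sum_inv_normc_cvg :
  cvgn (fun n => \sum_(0 <= j < n | D j) normc (zs j)^-1).
Proof.
have h : tends (partial_sum D (fun j => `|zs j|^-1))
    (limn (partial_sum D (fun j => `|zs j|^-1))) by exact: hcvg.
have [{}h _] := (tends_ReIm _ _).1 h.
apply/cvg_ex; eexists; apply: cvgn_ext h => n.
rewrite /partial_sum raddf_sum; apply: eq_bigr => j _.
by rewrite normC_normc -fmorphV /= Normc.normcV.
Qed.

Lemma sum_inv_normc_bounded :
  exists2 M : R, 0 <= M &
    forall n, \sum_(0 <= j < n | D j) normc (zs j)^-1 <= M.
Proof.
set S := (fun n => \sum_(0 <= j < n | D j) normc (zs j)^-1).
have nd : {homo S : n m / (n <= m)%N >-> n <= m}.
  move=> n m nm; rewrite /S (big_cat_nat (leq0n n) nm)/= lerDl.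
  by apply: sumr_ge0 => j _; exact: normc_ge0.
exists (limn S) => [|n]; last first.
  exact: nondecreasing_cvgn_le nd sum_inv_normc_cvg n.
apply: le_trans (nondecreasing_cvgn_le nd sum_inv_normc_cvg 0).
by rewrite /S big_geq.
Qed.

Lemma sum_inv_tends :
  tends (partial_sum D (fun j => (zs j)^-1)) (csum D (fun j => (zs j)^-1)).
Proof.
have hr : cvgn (fun n => \sum_(0 <= j < n | D j) Re (zs j)^-1).
  by apply: dominated_sum_cvg sum_inv_normc_cvg => j _; exact: normc_Re_le.
have hi : cvgn (fun n => \sum_(0 <= j < n | D j) Im (zs j)^-1).
  by apply: dominated_sum_cvg sum_inv_normc_cvg => j _; exact: normc_Im_le.
move/cvg_ex: hr => [x hx]; move/cvg_ex: hi => [y hy].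
have h : tends (partial_sum D (fun j => (zs j)^-1)) (x +i* y).
  apply/tends_ReIm; split.
    by apply: cvgn_ext hx => n; rewrite /partial_sum raddf_sum.
  by apply: cvgn_ext hy => n; rewrite /partial_sum raddf_sum.
by rewrite /csum (tends_lim h).
Qed.

Definition root_prod n z : R[i] := \prod_(0 <= j < n | D j) (1 - z / zs j).

Definition canonical_prod z : R[i] := limn (root_prod^~ z : nat -> R[i]^o).

(** Since the sum of the 1 / z_j converges, the exponential convergence
    factors can be split off the product. *)
Lemma root_prod_tends z (P : R[i]) :
  tends (partial_prod D (fun j => (1 - z / zs j) * cexp (z / zs j))) P ->
  tends (root_prod^~ z) (canonical_prod z) /\
  P = canonical_prod z * cexp (z * csum D (fun j => (zs j)^-1)).
Proof.
set S := csum _ _ => hP.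
pose T := partial_sum D (fun j => (zs j)^-1).
have hE : tends (fun n => cexp (z * T n)) (cexp (z * S)).
  exact: tends_cexp (tendsM (@tends_cst R z) sum_inv_tends).
have h := tendsM hP (tendsV (cexp_neq0 _) hE).
have {}h : tends (root_prod^~ z) (P / cexp (z * S)).
  apply: tends_ext h => n; rewrite /partial_prod big_split /= -[LHS]mulrA.
  rewrite [X in _ * (X / _)](_ : _ = cexp (z * T n)).
    by rewrite divff ?mulr1 ?cexp_neq0.
  rewrite /T /partial_sum mulr_sumr.
  by rewrite (big_morph (@cexp R) (@cexpD R) (@cexp0 R)).
have e : canonical_prod z = P / cexp (z * S) := tends_lim h.
by split; [rewrite e | rewrite e divfK ?cexp_neq0].
Qed.

Lemma root_prod_real_ge1 n (x : R) : 0 <= x -> 1 <= normc (root_prod n x%:C).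
Proof.
move=> x0; rewrite /root_prod normc_prod; elim/big_rec: _ => // j p Dj hp.
rewrite -[1]mulr1; apply: ler_pM => //.
apply: le_trans (normc_Re_le _); apply: le_trans (ler_norm _).
have := Re_opp_inv_ge0 Dj; case: (zs j)^-1 => a b /= a0.
by rewrite mul0r subr0 lerDl -mulrN mulr_ge0.
Qed.

Lemma root_prod_opp_real_le n (x : R) : 0 <= x ->
  normc (root_prod n (- x%:C)) <= normc (root_prod n x%:C).
Proof.
move=> x0; rewrite /root_prod !normc_prod; apply: ler_prod => j Dj.
rewrite normc_ge0 /=.
have := @linear_factor_reflect_le R (- (zs j)^-1) x%:C (Re_opp_inv_ge0 Dj) x0.
have -> : (x%:C)^* = x%:C by rewrite /= oppr0.
by rewrite !mulrN !mulNr ![_ * _^-1]mulrC opprK.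
Qed.

(** The bound is uniform in n, so that it gives the continuity at 0+ of the
    limit product. *)
Lemma root_prod_sub1 : exists2 M : R, 0 <= M & forall n (x : R), 0 <= x ->
  normc (root_prod n x%:C - 1) <= expR (x * M) - 1.
Proof.
have [M M0 hM] := sum_inv_normc_bounded; exists M => // n x x0.
apply: le_trans (normc_prod1D_sub1 _ _ _) _.
rewrite lerB// ler_expR; apply: le_trans (ler_wpM2l x0 (hM n)).
rewrite mulr_sumr; apply: ler_sum => j _.
by rewrite normcN Normc.normcM normcR ger0_norm.
Qed.

(** The factors (1 + bz/n)^n and (1 + Az^2/n)^n approximate exp (bz) and exp
    (A z^2). For A > 0 the second has the imaginary roots +-i sqrt(n/A), which
    is where A >= 0 enters. Here n is shifted by one to avoid a division by 0,
    and so that the first slope always exists and has a positive real part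
    when b > 0. *)
Definition approx_slopes (A b : R) n : seq R[i] :=
  nseq n.+1 (b / n.+1%:R)%:C ++
  (nseq n.+1 ('i * (Num.sqrt (A / n.+1%:R))%:C) ++
  (nseq n.+1 (- ('i * (Num.sqrt (A / n.+1%:R))%:C)) ++
  [seq - (zs j)^-1 | j <- index_iota 0 n & D j])).

Lemma complex_div_nat (c : R) n : (c / n.+1%:R)%:C = c%:C / n.+1%:R :> R[i].
Proof. by rewrite rmorphM fmorphV rmorph_nat. Qed.

Lemma approx_slopes_ge0 A b n : 0 <= b ->
  {in approx_slopes A b n, forall a, 0 <= Re a}.
Proof.
move=> b0 a; rewrite !mem_cat => /or4P[].
- by move=> /nseqP[-> _] /=; rewrite divr_ge0.
- by move=> /nseqP[-> _] /=; rewrite mul0r mulr0 subr0.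
- by move=> /nseqP[-> _] /=; rewrite mul0r mulr0 subr0 oppr0.
- move=> /mapP[j]; rewrite mem_filter => /andP[Dj _] ->.
  exact: Re_opp_inv_ge0.
Qed.

Lemma horner_approx A b n z : 0 <= A ->
  (linear_prod (approx_slopes A b n)).[z] =
  (1 + b%:C * z / n.+1%:R) ^+ n.+1 *
  ((1 + A%:C * z ^+ 2 / n.+1%:R) ^+ n.+1 * root_prod n z).
Proof.
move=> A0; rewrite horner_linear_prod !big_cat !big_nseq !iter_mulr_1 /=.
rewrite big_map big_filter /root_prod.
congr (_ * _); first by rewrite complex_div_nat mulrAC.
rewrite mulrA -exprMn; congr (_ * _); last first.
  by apply: eq_bigr => j _; rewrite mulNr [_^-1 * _]mulrC.
congr (_ ^+ _); set g := Num.sqrt _.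
have -> : (1 + 'i * g%:C * z) * (1 + - ('i * g%:C) * z) =
    1 - 'i ^+ 2 * g%:C ^+ 2 * z ^+ 2 by ring.
have Eg : g%:C ^+ 2 = A%:C / n.+1%:R :> R[i].
  rewrite -complex_div_nat -(@sqr_sqrtr _ (A / n.+1%:R)) ?divr_ge0//.
  by rewrite !expr2 rmorphM.
by rewrite sqr_i Eg; ring.
Qed.

Lemma approx_slopes_sum A b n : 0 <= b ->
  b <= Re (\sum_(a <- approx_slopes A b n) a).
Proof.
move=> b0; rewrite /approx_slopes big_cat raddfD.
rewrite [X in Re X + _](_ : _ = b%:C); last first.
  rewrite big_nseq iter_addr_0 -[LHS]mulr_natr.
  by rewrite complex_div_nat divfK// pnatr_eq0.
rewrite lerDl raddf_sum big_seq sumr_ge0// => a ha.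
by apply: (@approx_slopes_ge0 A b n b0); rewrite mem_cat ha orbT.
Qed.

Lemma approx_tends A b z : 0 <= A ->
  tends (root_prod^~ z) (canonical_prod z) ->
  tends (fun n => (linear_prod (approx_slopes A b n)).[z])
    (cexp (b%:C * z) * (cexp (A%:C * z ^+ 2) * canonical_prod z)).
Proof.
move=> A0 h.
have := tendsM (@tends_exp R (b%:C * z))
  (tendsM (@tends_exp R (A%:C * z ^+ 2)) h).
by apply: tends_ext => n; rewrite horner_approx.
Qed.

End CanonicalProduct.

(** * Sections modulo 4 *)

Section QuarterSections.
Variable R : realType.
Implicit Types (z w : R[i]).

Lemma i_exp4 : ('i : R[i]) ^+ 4 = 1.
Proof. by rewrite (exprM 'i 2 2) sqr_i sqrrN expr1n. Qed.

Lemma sum_powers_i m :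
  1 + 'i ^+ m + ('i ^+ m) ^+ 2 + ('i ^+ m) ^+ 3 =
  (if (4 %| m)%N then 4 else 0) :> R[i].
Proof.
have e : 'i ^+ m = 'i ^+ (m %% 4) :> R[i].
  by rewrite [in LHS](divn_eq m 4) exprD mulnC exprM i_exp4 expr1n mul1r.
rewrite e /dvdn; have : (m %% 4 < 4)%N by rewrite ltn_mod.
have i2 : 'i ^+ 2 = -1 :> R[i] := sqr_i R.
have i3 : 'i ^+ 3 = - 'i :> R[i] by rewrite exprS i2 mulrN1.
case: (m %% 4)%N => [|[|[|[|//]]]] _ /=.
- by rewrite expr0 !expr1n; ring.
- by rewrite expr1 i3 i2; ring.
- by rewrite i2; ring.
- by rewrite i3 (exprS (- 'i) 2) sqrrN i2; ring.
Qed.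

(** Averaging over the fourth roots of unity selects the exponents congruent
    to r; the weights i^(-kr) are written as i^(3kr) to keep exponents
    natural. *)
Lemma quarter_section_average (a : nat -> R) (f : R[i] -> R[i]) r z :
  entire_with_coefs (fun j => (a j)%:C) f ->
  4 * section4 a r z = f z + 'i ^+ (3 * r) * f ('i * z)
    + ('i ^+ (3 * r)) ^+ 2 * f (- z) + ('i ^+ (3 * r)) ^+ 3 * f (- ('i * z)).
Proof.
move=> hf; set e := 'i ^+ (3 * r); set F := (X in _ = X).
have four0 : (4 : R[i]) != 0 by rewrite pnatr_eq0.
suff h : tends (partial_sum (fun j => j == r %[mod 4])%N
    (fun j => (a j)%:C * z ^+ j)) (4^-1 * F).
  by rewrite /section4 /csum (tends_lim h) mulVKf.
have hF := tendsM (@tends_cst R 4^-1) (tendsD (tendsD (tendsD (hf z)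
  (tendsM (@tends_cst R e) (hf ('i * z))))
  (tendsM (@tends_cst R (e ^+ 2)) (hf (- z))))
  (tendsM (@tends_cst R (e ^+ 3)) (hf (- ('i * z))))).
apply: tends_ext hF => n.
rewrite /partial_sum !mulr_sumr -!big_split /= mulr_sumr [RHS]big_mkcond.
apply: eq_bigr => j _.
have i2 : 'i ^+ 2 = -1 :> R[i] := sqr_i R.
have -> : - z = 'i ^+ 2 * z by rewrite i2 mulN1r.
have -> : - ('i * z) = 'i ^+ 3 * z by rewrite exprS i2 mulrN1 mulNr.
have E : e * 'i ^+ j = 'i ^+ (3 * r + j) by rewrite exprD.
have -> : (j == r %[mod 4])%N = (4 %| 3 * r + j)%N by lia.
have := sum_powers_i (3 * r + j); rewrite -E => S.
transitivity (4^-1 * ((a j)%:C * z ^+ j * (1 + e * 'i ^+ j +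
    (e * 'i ^+ j) ^+ 2 + (e * 'i ^+ j) ^+ 3))).
  by rewrite !exprMn; ring.
rewrite S; case: ifP => _; last by rewrite !mulr0.
by rewrite mulrA mulrC mulrA divff// mul1r.
Qed.

Lemma real_entire_conj (a : nat -> R) (f : R[i] -> R[i]) z :
  entire_with_coefs (fun j => (a j)%:C) f -> f z^* = (f z)^*.
Proof.
move=> hf; apply: tends_unique (hf z^*) _.
apply: tends_ext (tends_conj (hf z)) => n.
rewrite /partial_sum rmorph_sum; apply: eq_bigr => j _.
by rewrite rmorphM rmorphXn; congr (_ * _); exact: conjc_real.
Qed.

(** The four rays together are the set Re z^2 = 0. *)
Lemma quarter_rays z :
  (0 < Re (z ^+ 2) -> False) -> (Re (z ^+ 2) < 0 -> False) ->
  Im (z ^+ 4) = 0 /\ Re (z ^+ 4) <= 0.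
Proof.
move=> h1 h2; have h : Re (z ^+ 2) = 0.
  by apply/eqP; rewrite eq_le !leNgt; apply/andP; split; apply/negP.
rewrite (exprM z 2 2); case: (z ^+ 2) h => u v h.
have {h} -> : u = 0 := h; rewrite expr2 /= !mul0r mulr0 addr0 sub0r; split=> //.
by rewrite oppr_le0 -expr2 sqr_ge0.
Qed.

(** As e^2 = 1 or e^2 = -1, the combination groups into even parts or into odd
    parts of L at z and at iz, one of them multiplied by e of modulus 1; such
    a sum cannot vanish when the two moduli differ. *)
Lemma quarter_turn_combination_neq0 (L : R[i] -> R[i]) z e :
  e ^+ 4 = 1 ->
  normc (L ('i * z) + L (- ('i * z))) != normc (L z + L (- z)) ->
  normc (L ('i * z) - L (- ('i * z))) != normc (L z - L (- z)) ->
  L z + e * L ('i * z) + e ^+ 2 * L (- z) + e ^+ 3 * L (- ('i * z)) != 0.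
Proof.
move=> e4 hE hO; have ne : normc e = 1.
  have := congr1 (@Normc.normc R) e4; rewrite normcX Normc.normc1.
  by move/eqP; rewrite pexpr_eq1 ?normc_ge0// => /eqP.
have : (e ^+ 2) ^+ 2 = 1 by rewrite -exprM.
move=> /eqP; rewrite sqrf_eq1 => /orP[] /eqP e2.
- apply: contra_neq hE => h.
  have -> : L z + L (- z) = - e * (L ('i * z) + L (- ('i * z))).
    apply/eqP; rewrite -subr_eq0; apply/eqP; rewrite -h (exprS e 2) e2; ring.
  by rewrite Normc.normcM normcN ne mul1r.
- apply: contra_neq hO => h.
  have -> : L z - L (- z) = - e * (L ('i * z) - L (- ('i * z))).
    apply/eqP; rewrite -subr_eq0; apply/eqP; rewrite -h (exprS e 2) e2; ring.
  by rewrite Normc.normcM normcN ne mul1r.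
Qed.

End QuarterSections.

(** * The factorized real entire function *)

Section RealFactorization.
Variable R : realType.
Implicit Types (z w : R[i]).
Variables (a : nat -> R) (f : R[i] -> R[i]) (p : nat) (A B : R) (C : R[i]).
Variables (D : pred nat) (zs : nat -> R[i]).
Hypothesis hf : entire_with_coefs (fun j => (a j)%:C) f.
Hypothesis hW : weierstrass_factorization f p A B C D zs.
Hypothesis hre : forall j, D j -> Re (zs j) < 0.
Hypothesis hA : 0 <= A.
Hypothesis hcvg : cvgn (partial_sum D (fun j => `|zs j|^-1)).
Variable b : R.
Hypothesis b_gt0 : 0 < b.
Hypothesis hb : b%:C = B%:C + csum D (fun j => (zs j)^-1).

(** This is f without its factor z^p exp C, with the convergence factors of
    the product absorbed into the linear term of the exponent. *)
Definition normalized z := cexp (b%:C * z) *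
  (cexp (A%:C * z ^+ 2) * canonical_prod D zs z).

Lemma canonical_prod_tends z :
  tends ((root_prod D zs)^~ z) (canonical_prod D zs z).
Proof. by have [P hP _] := hW z; have [] := root_prod_tends hcvg hP. Qed.

Lemma factorization_normalized z : f z = z ^+ p * cexp C * normalized z.
Proof.
have [P hP ->] := hW z; have [_ ->] := root_prod_tends hcvg hP.
rewrite /normalized hb mulrDl !cexpD [csum _ _ * z]mulrC; ring.
Qed.

Lemma canonical_prod_sub1 : exists2 M : R, 0 <= M & forall x : R, 0 <= x ->
  normc (canonical_prod D zs x%:C - 1) <= expR (x * M) - 1.
Proof.
have [M M0 hM] := root_prod_sub1 hcvg; exists M => // x x0.
have h := tends_normc (tendsB (@canonical_prod_tends x%:C) (@tends_cst R 1)).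
apply: (ler_cvg_to h (cvg_cst _)); apply: nearW => n; exact: hM.
Qed.

(** For real x > 0 every factor 1 - x/z_j has modulus at least 1 and at least
    that of 1 + x/z_j, so the difference is at least exp(bx) - exp(-bx). The
    quadratic term is needed for the odd part, which is divided by x. *)
Lemma normalized_growth (x : R) : 0 < x ->
  b * x + (b * x) ^+ 2 / 4 <=
  normc (normalized x%:C) - normc (normalized (- x%:C)).
Proof.
move=> x0; set q := normc (canonical_prod D zs x%:C).
have q1 : 1 <= q.
  apply: (ler_cvg_to (cvg_cst _) (tends_normc (@canonical_prod_tends x%:C))).
  by apply: nearW => n; apply: root_prod_real_ge1 => //; exact: ltW.
have q2 : normc (canonical_prod D zs (- x%:C)) <= q.
  apply: tends_normc_le (@canonical_prod_tends _) (@canonical_prod_tends _) _.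
  move=> n.
  by apply: root_prod_opp_real_le => //; exact: ltW.
have N u v c : normc (cexp u * (cexp v * c)) =
    expR (Re u) * (expR (Re v) * normc c) :> R.
  rewrite (Normc.normcM (cexp u)) (Normc.normcM (cexp v) c).
  by rewrite (normc_cexp u) (normc_cexp v).
rewrite /normalized !N sqrrN -/q.
have -> : Re (A%:C * x%:C ^+ 2) = A * x ^+ 2.
  by rewrite -rmorphXn -rmorphM.
have -> : Re (b%:C * x%:C) = b * x by rewrite -rmorphM.
have -> : Re (b%:C * - x%:C) = - (b * x) by rewrite -rmorphN -rmorphM mulrN.
have bx0 : 0 < b * x by rewrite mulr_gt0.
have e1 : 1 <= expR (A * x ^+ 2) by rewrite -expR0 ler_expR mulr_ge0 ?sqr_ge0.
have e2 : expR (- (b * x)) <= 1 by rewrite -expR0 ler_expR oppr_le0 ltW.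
have e3 : (1 + b * x / 2) ^+ 2 <= expR (b * x).
  rewrite [X in expR X](_ : _ = 2%:R * (b * x / 2)); last by field.
  rewrite expRM_natl ler_sqr ?nnegrE ?expR_ge0 ?expR_ge1Dx//; lra.
set E := expR (A * _) in e1 *; set q' := normc _ in q2 *.
have en : 0 < expR (- (b * x)) by rewrite expR_gt0.
have h1 : expR (- (b * x)) * (E * q') <= expR (- (b * x)) * (E * q).
  by rewrite !ler_wpM2l// ?(ltW en)//; lra.
have h2 : expR (b * x) - 1 <= (expR (b * x) - expR (- (b * x))) * (E * q).
  have : 1 <= E * q by rewrite -[1]mulr1 ler_pM.
  have : 0 <= expR (b * x) - expR (- (b * x)) by have := sqr_ge0 (b * x); lra.
  by nra.
by have := sqr_ge0 (b * x); lra.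
Qed.

(** For x > 0 the number f(x) is real, hence exp C times the canonical product
    at x is real; this product tends to 1 as x tends to 0+. The point x below
    is chosen so that the deviation from 1 is too small to cancel an imaginary
    part of modulus k of exp C. *)
Lemma cexp_const_real : (cexp C)^* = cexp C.
Proof.
have [M M0 hM] := canonical_prod_sub1.
have real x : 0 < x -> Im (cexp C * canonical_prod D zs x%:C) = 0.
  move=> x0; have h := factorization_normalized x%:C.
  have hI : Im (f x%:C) = 0.
    have := real_entire_conj x%:C hf; rewrite conjc_real.
    case: (f x%:C) => u v [] /eqP.
    by rewrite -addr_eq0 -mulr2n mulrn_eq0 => /eqP.
  have e : f x%:C = (x ^+ p * expR (b * x) * expR (A * x ^+ 2))%:C *
      (cexp C * canonical_prod D zs x%:C).
    rewrite h /normalized -!rmorphXn -!rmorphM !cexp_real !rmorphM; ring.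
  have k0 : x ^+ p * expR (b * x) * expR (A * x ^+ 2) != 0.
    by rewrite !mulf_neq0 ?expf_neq0 ?gt_eqF ?expR_gt0.
  move: hI; rewrite e; case: (cexp C * _) => u v /=.
  by rewrite mul0r addr0 => /eqP; rewrite mulf_eq0 (negPf k0) => /eqP.
suff h : Im (cexp C) = 0 by case: (cexp C) h => u v /= ->; rewrite oppr0.
apply/eqP; rewrite -normr_le0 leNgt; apply/negP => k0.
set k := `|_| in k0; set K := normc (cexp C).
have K0 : 0 < K by rewrite /K normc_gt0 cexp_neq0.
have l0 : 0 < ln (1 + k / (2 * K)).
  by rewrite ln_gt0// ltrDl divr_gt0// mulr_gt0.
pose x := ln (1 + k / (2 * K)) / (M + 1).
have x0 : 0 < x by rewrite divr_gt0//; lra.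
have h1 : normc (canonical_prod D zs x%:C - 1) <= k / (2 * K).
  apply: le_trans (hM _ (ltW x0)) _; rewrite lerBlDl.
  apply: (@le_trans _ _ (expR (x * (M + 1)))).
    by rewrite ler_expR ler_wpM2l ?(ltW x0)// lerDl.
  rewrite /x divfK ?gt_eqF//; last by lra.
  by rewrite lnK// posrE addr_gt0// divr_gt0// mulr_gt0.
have h2 : k <= K * normc (canonical_prod D zs x%:C - 1).
  rewrite -Normc.normcM; apply: le_trans (normc_Im_le _).
  by rewrite mulrBr mulr1 raddfB /= real// sub0r normrN.
have h3 : K * (k / (2 * K)) = k / 2 by field; rewrite gt_eqF.
have : K * normc (canonical_prod D zs x%:C - 1) <= K * (k / (2 * K)).
  by rewrite ler_pM2l.
by rewrite h3; lra.
Qed.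

Lemma normalized_conj z : z != 0 -> normalized z^* = (normalized z)^*.
Proof.
move=> z0; have := real_entire_conj z hf.
have conjM (u v : R[i]) : (u * v)^* = u^* * v^* by rewrite rmorphM.
rewrite !factorization_normalized (conjM (_ * _)) (conjM _ (cexp C)) rmorphXn.
rewrite cexp_const_real => /mulfI; apply.
by rewrite mulf_neq0 ?cexp_neq0 ?expf_neq0// conjc_eq0.
Qed.

(** The approximants satisfy the strict reflection inequality because their
    first slope b/n is positive. *)
Lemma normalized_quarter_turn z : 0 < Re (z ^+ 2) ->
  normc (normalized ('i * z) + normalized (- ('i * z))) <
    normc (normalized z + normalized (- z)) /\
  normc (normalized ('i * z) - normalized (- ('i * z))) <
    normc (normalized z - normalized (- z)).
Proof.
move=> hz; pose P n := linear_prod (approx_slopes D zs A b n).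
have hP n y : 0 < Re y -> normc (P n).[- y^*] < normc (P n).[y].
  move=> y0; have hs : {in approx_slopes D zs A b n, forall c, 0 <= Re c}.
    by apply: approx_slopes_ge0 => //; exact: ltW.
  apply: linear_prod_reflect_lt => //=; first by rewrite divr_gt0.
  by move=> c hc; apply: hs; rewrite inE hc orbT.
have hP0 n : (P n).[0] = 1 by exact: linear_prod0.
have hP1 n : b <= Re (P n)`_1.
  by rewrite linear_prod_coef1; apply: approx_slopes_sum => //; exact: ltW.
have hL y : y != 0 -> tends (fun n => (P n).[y]) (normalized y).
  by move=> _; have := @approx_tends _ D zs A b y hA (@canonical_prod_tends y).
split.
  exact: (even_part_quarter_turn hP hP0 b_gt0 hL normalized_conj
    normalized_growth hz).
exact: (odd_part_quarter_turn hP hP0 b_gt0 hP1 hL normalized_conj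
  normalized_growth hz).
Qed.

(** By the average formula, 4f_r(z) is z^p exp C times a combination of the
    values of the normalized function at i^k z, with e' = i^(3r + p). If Re
    z^2 < 0, the comparison is made at iz instead of z. *)
Lemma section_neq0 r z : Re (z ^+ 2) != 0 -> section4 a r z != 0.
Proof.
move=> hz; have z0 : z != 0 by apply: contraNneq hz => ->; rewrite expr0n.
have : 4 * section4 a r z != 0; last by rewrite mulf_eq0 negb_or => /andP[].
rewrite (quarter_section_average _ _ hf) !factorization_normalized.
set e := 'i ^+ (3 * r).
pose e' : R[i] := e * 'i ^+ p.
have i2 : 'i ^+ 2 = -1 :> R[i] := sqr_i R.
have np : (- z) ^+ p = 'i ^+ p ^+ 2 * z ^+ p.
  by rewrite -exprM mulnC exprM i2 -exprMn mulN1r.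
have nip : (- ('i * z)) ^+ p = 'i ^+ p ^+ 3 * z ^+ p.
  by rewrite -exprM mulnC exprM -exprMn exprS i2 mulrN1 mulNr.
rewrite np nip exprMn.
have e4 : e' ^+ 4 = 1.
  rewrite /e' exprMn -!exprM mulnC [(p * 4)%N]mulnC !(exprM _ 4) i_exp4.
  by rewrite !expr1n mulr1.
set N := normalized.
suff H : N z + e' * N ('i * z) + e' ^+ 2 * N (- z) +
    e' ^+ 3 * N (- ('i * z)) != 0.
  rewrite (_ : _ + _ = z ^+ p * cexp C * (N z + e' * N ('i * z) +
    e' ^+ 2 * N (- z) + e' ^+ 3 * N (- ('i * z)))); last first.
    by rewrite /e'; ring.
  by apply: mulf_neq0 H; apply: mulf_neq0 (cexp_neq0 C); exact: expf_neq0.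
move: hz; rewrite neq_lt => /orP[] hz; last first.
  have [h1 h2] := normalized_quarter_turn hz.
  by apply: quarter_turn_combination_neq0 => //; rewrite lt_eqF.
have ii : 'i * ('i * z) = - z by rewrite mulrA -expr2 i2 mulN1r.
have hz' : 0 < Re (('i * z) ^+ 2).
  by rewrite exprMn i2 mulN1r raddfN oppr_gt0.
have [h1 h2] := normalized_quarter_turn hz'; rewrite ii opprK in h1 h2.
apply: quarter_turn_combination_neq0 => //.
  by rewrite gt_eqF// addrC.
by rewrite gt_eqF// -normcN opprB.
Qed.

End RealFactorization.

(* In hsum, 0 < x in R[i] means that x is real and positive; the sum is real
   because the zeros of f are symmetric under conjugation. *)
Theorem theorem4 (R : realType) (a : nat -> R) (f : R[i] -> R[i])
    (p : nat) (A B : R) (C : R[i]) (D : pred nat) (zs : nat -> R[i])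
    (hf : entire_with_coefs (fun j => (a j)%:C) f)
    (hzs : lists_nonzero_zeros f D zs)
    (hW : weierstrass_factorization f p A B C D zs)
    (hre : forall j, D j -> complex.Re (zs j) < 0)
    (hA : 0 <= A)
    (hcvg : cvgn (partial_sum D (fun j => `|zs j|^-1)))
    (hsum : 0 < B%:C + csum D (fun j => (zs j)^-1)) :
  forall r : nat, (r < 4)%N ->
  forall z : R[i], section4 a r z = 0 ->
    complex.Im (z ^+ 4) = 0 /\ complex.Re (z ^+ 4) <= 0.
Proof.
move=> r _ z hz.
have [b b0 hb] : exists2 b : R,
    0 < b & b%:C = B%:C + csum D (fun j => (zs j)^-1).
  move: hsum; rewrite ltcE; case: (_ + _) => u v /= /andP[/eqP -> u0].
  by exists u.
have hne : Re (z ^+ 2) != 0 -> False.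
  by move=> /(section_neq0 hf hW hre hA hcvg b0 hb r); rewrite hz eqxx.
apply: quarter_rays => h; apply: hne; first by rewrite gt_eqF.
by rewrite lt_eqF.
Qed.
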